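(* Fix a positive integer $n$. For a prime $p$, identify $\mathbb{F}_p=\mathbb{Z}/p\mathbb{Z}=\{\bar 0,\bar 1,\dots,\overline{p-1}\}$ and, for $A=(\overline{a_{ij}})\in \mathrm{GL}_n(\mathbb{F}_p)$ with $a_{ij}\in\{0,1,\dots,p-1\}$, write $A^{-1}=(\overline{b_{ij}})$ with $b_{ij}\in\{0,1,\dots,p-1\}$. Define $$g_p:\mathrm{GL}_n(\mathbb{F}_p)\to[0,1]^{2n^2},\qquad A\mapsto \Big(\tfrac{a_{ij}}{p}\Big)_{1\le i,j\le n}\ \text{together with}\ \Big(\tfrac{b_{ij}}{p}\Big)_{1\le i,j\le n},$$ i.e. the point whose $2n^2$ coordinates are the $n^2$ numbers $a_{ij}/p$ and the $n^2$ numbers $b_{ij}/p$ (in a fixed order). Let $R\subset[0,1]^{2n^2}$ be a measurable set with the following property: for every $\epsilon>0$ there exist two finite collections of non-overlapping rectangles $R_1,\dots,R_k$ and $R^1,\dots,R^l$ such that $\bigcup_{i=1}^k R_i\subset R\subset\bigcup_{j=1}^l R^j$, $\mathrm{area}(R\setminus\bigcup_{i=1}^k R_i)<\epsilon$ and $\mathrm{area}(\bigcup_{j=1}^l R^j\setminus R)<\epsilon$. Then $$\lim_{p\to\infty}\frac{\#(\mathrm{Image}(g_p)\cap R)}{\#\mathrm{GL}_n(\mathbb{F}_p)}=\mathrm{area}(R),$$ where the limit is over primes $p$.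
   Context: A rectangle in $[0,1]^{d}$ means a box, i.e. a product $I_1\times\cdots\times I_d$ of subintervals of $[0,1]$. ''area'' denotes $d$-dimensional Lebesgue measure. $\mathrm{GL}_n(\mathbb{F}_p)$ is the group of invertible $n\times n$ matrices over $\mathbb{F}_p$. *)

(* Defs.v *)
From HB Require Import structures.
From mathcomp Require Import all_boot all_order all_algebra finmap.
From mathcomp Require Import all_classical all_reals all_analysis.

Set Implicit Arguments.
Unset Strict Implicit.
Unset Printing Implicit Defensive.

Import Order.TTheory GRing.Theory Num.Theory.
Import numFieldNormedType.Exports.

Local Open Scope classical_set_scope.
Local Open Scope ring_scope.

Definition closed_box (R : realType) (d : nat) (a b : 'rV[R]_d) :
  set 'rV[R]_d := [set x : 'rV[R]_d | forall i, a 0 i <= x 0 i <= b 0 i].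

Definition box_volume (R : realType) (d : nat) (a b : 'rV[R]_d) : R :=
  \prod_(i < d) (b 0 i - a 0 i).

(* Lebesgue outer measure on R^d, for d > 0. On Lebesgue measurable sets it is
   the d-dimensional Lebesgue measure. (For d = 0 the empty set has no cover of
   total volume 0.) *)
Definition area (R : realType) (d : nat) (X : set 'rV[R]_d) : \bar R :=
  ereal_inf [set s | exists a b : nat -> 'rV[R]_d,
    [/\ forall k i, a k 0 i <= b k 0 i,
        X `<=` \bigcup_k closed_box (a k) (b k) &
        s = (\sum_(0 <= k <oo) (box_volume (a k) (b k))%:E)%E]].

Definition lebesgue_measurable (R : realType) (d : nat) (X : set 'rV[R]_d) :
  Prop := (@area R d).-caratheodory X.

Definition unit_cube (R : realType) (d : nat) : set 'rV[R]_d :=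
  [set x : 'rV[R]_d | forall i, x 0 i \in `[0, 1]].
Arguments unit_cube : clear implicits.

(* The factors may be open, half-open, closed or degenerate intervals. *)
Definition is_rectangle (R : realType) (d : nat) (B : set 'rV[R]_d) : Prop :=
  exists I : 'I_d -> interval R,
    (forall i, [set` I i] `<=` [set` `[0, 1]]) /\
    B = [set x : 'rV[R]_d | forall i, x 0 i \in I i].

Definition non_overlapping (R : realType) (d k : nat)
    (B : 'I_k -> set 'rV[R]_d) : Prop :=
  forall i j, i != j -> (B i)° `&` (B j)° = set0.

Definition approximable_by_rectangles (R : realType) (d : nat)
    (X : set 'rV[R]_d) : Prop :=
  forall e : R, 0 < e ->
  exists (k l : nat) (inner : 'I_k -> set 'rV[R]_d)
         (outer : 'I_l -> set 'rV[R]_d),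
  [/\ (forall i, is_rectangle (inner i)) /\ non_overlapping inner,
      (forall j, is_rectangle (outer j)) /\ non_overlapping outer,
      \bigcup_i inner i `<=` X /\ X `<=` \bigcup_j outer j,
      (area (X `\` \bigcup_i inner i) < e%:E)%E &
      (area (\bigcup_j outer j `\` X) < e%:E)%E].

Definition GL (n p : nat) : {set 'M['F_p]_n} :=
  [set A : 'M['F_p]_n | A \in unitmx].

(* For p prime, the coercion of x : 'F_p to nat is the representative of x in
   {0, ..., p - 1}. *)
Definition scaled_lift (R : realType) (n p : nat) (A : 'M['F_p]_n) :
  'M[R]_n := \matrix_(i, j) ((A i j : nat)%:R / p%:R).
Arguments scaled_lift R {n p} A.

(* The 2 n^2 coordinates are ordered row by row, those of A before those of its
   inverse. *)
Definition g (R : realType) (n p : nat) (A : 'M['F_p]_n) :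
  'rV[R]_(n * n + n * n) :=
  row_mx (mxvec (scaled_lift R A)) (mxvec (scaled_lift R (invmx A))).
Arguments g R {n p} A.

(* A finite set, so [fset_set] is meaningful on its subsets. *)
Definition image_g (R : realType) (n p : nat) : set 'rV[R]_(n * n + n * n) :=
  [set g R A | A in [set` GL n p]].
Arguments image_g : clear implicits.

(* Main.v *)
(* Write mu_p(X) for the proportion of A in GL_n(F_p) whose image under g lies
   in X.

   Averaging over A |-> t A, with t in F_p^*, turns the exponential sum of
   (A, A^-1) at a nonzero frequency into an average of Kloosterman sums. By
   Kloosterman's fourth moment argument these are O(p^(3/4)), except for the A
   lying on a hyperplane, where the trivial bound p suffices; so the exponential
   sums are o(#GL_n(F_p)) uniformly in the frequency. Majorizing the indicator
   function of an interval by a convolution of two indicator functions, whose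
   Fourier transform has bounded l^1 norm, gives limsup mu_p(B) <= vol(B) for
   every closed box B.

   Upper bounds for boxes suffice. By compactness limsup mu_p(K) <= area(K) for
   every compact K. Replacing rectangles by their closures or interiors costs
   only degenerate boxes; this bounds mu_p(E) by means of the outer rectangles
   and mu_p(cube - E) by means of the inner ones, and Caratheodory's condition
   gives area(cube - E) <= 1 - area(E). *)

Require Import Defs.
From HB Require Import structures.
From mathcomp Require Import all_boot all_order all_algebra.
From mathcomp Require Import finfield finmap complex ring lra zify.
From mathcomp Require Import all_classical all_reals all_analysis.

Set Implicit Arguments.
Unset Strict Implicit.
Unset Printing Implicit Defensive.

Import Order.TTheory GRing.Theory Num.Theory.
Import numFieldNormedType.Exports.

Local Open Scope ring_scope.

(** * Kloosterman sums and exponential sums over GL_n *)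

(** Expanding the square and summing over [u] first leaves, by orthogonality, only the pairs with
    [h t = h s]. With [h] the identity this is Parseval's identity; with [h] a sum map it counts the
    quadruples in the fourth moment. *)
Lemma sum_sqr_norm_orthogonal (C : numClosedFieldType) (X V T : finType)
    (e : X -> V -> C) (N : nat) (Q : {set T}) (h : T -> V) :
  (forall v w, \sum_u e u v * (e u w)^* = N%:R *+ (v == w)) ->
  \sum_u `|\sum_(t in Q) e u (h t)| ^+ 2 =
  N%:R * #|[set s : T * T | [&& s.1 \in Q, s.2 \in Q & h s.1 == h s.2]]|%:R.
Proof.
move=> orth; transitivity (\sum_u \sum_(t in Q) \sum_(s in Q)
    e u (h t) * (e u (h s))^*).
  apply: eq_bigr => u _; rewrite normCK rmorph_sum /= mulr_suml.
  by apply: eq_bigr => t _; rewrite mulr_sumr.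
rewrite exchange_big /=.
under eq_bigr => t _ do rewrite exchange_big /=.
under eq_bigr => t _ do under eq_bigr => s _ do rewrite orth mulrb.
rewrite pair_big -big_mkcondr /= sumr_const mulr_natr; congr (_ *+ _).
by apply: eq_card => -[t s]; rewrite !inE /= andbA.
Qed.

Section AdditiveCharacter.
Variables (C : numClosedFieldType) (F : finFieldType) (psi : F -> C).
Hypotheses (psi0 : psi 0 = 1) (psiD : {morph psi : x y / x + y >-> x * y}).
Hypothesis psi_nontrivial : exists x, psi x != 1.

Lemma psi_sum (I : Type) (r : seq I) (P : pred I) (f : I -> F) :
  psi (\sum_(i <- r | P i) f i) = \prod_(i <- r | P i) psi (f i).
Proof. exact: (big_morph psi psiD psi0). Qed.

(** In characteristic p one has psi(x)^p = psi(px) = 1, and a nonnegative number whose p-th power is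
    1 equals 1. *)
Lemma norm_psi x : `|psi x| = 1.
Proof.
have [p p_pr p_char] := finPcharP F.
have psiX n : psi (x *+ n) = psi x ^+ n.
  by elim: n => [|n IH]; rewrite ?expr0 // mulrS psiD IH exprS.
apply/eqP; rewrite -(pexpr_eq1 (prime_gt0 p_pr)) // -normrX -psiX.
by rewrite -mulr_natr (pcharf0 p_char) mulr0 psi0 normr1.
Qed.

Lemma conj_psi x : (psi x)^* = psi (- x).
Proof.
have psi_neq0 : psi x != 0 by rewrite -normr_eq0 norm_psi oner_eq0.
apply: (mulfI psi_neq0); rewrite -normCK norm_psi expr1n -psiD subrr psi0 //.
Qed.

Lemma sum_psi a : \sum_x psi (a * x) = #|F|%:R *+ (a == 0).
Proof.
case: eqVneq => [->|a0].
  by under eq_bigr => x _ do rewrite mul0r psi0; rewrite sumr_const.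
(* Translating the summation variable by [a^-1 * y] multiplies the sum by [psi y], which is not 1,
   so the sum vanishes. *)
have [y psi_y] := psi_nontrivial.
have ay : psi (a * (a^-1 * y)) = psi y by rewrite mulrA divff // mul1r.
have bij : bijective (fun x => a^-1 * y + x).
  by exists (fun x => - (a^-1 * y) + x) => x; rewrite addrA ?addNr ?subrr add0r.
apply/eqP; have : \sum_x psi (a * x) = psi y * \sum_x psi (a * x).
  rewrite {1}(reindex _ (onW_bij _ bij)) /= mulr_sumr; apply: eq_bigr => x _.
  by rewrite mulrDr psiD ay.
move/eqP; rewrite -subr_eq0 -{1}[\sum_x _]mul1r -mulrBl mulf_eq0 subr_eq0.
by rewrite eq_sym (negPf psi_y).
Qed.

Lemma psi_orthogonal x y :
  \sum_u psi (u * x) * (psi (u * y))^* = #|F|%:R *+ (x == y).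
Proof.
rewrite -subr_eq0 -sum_psi; apply: eq_bigr => u _.
by rewrite conj_psi -psiD -mulrN -mulrDr mulrC.
Qed.

Definition kloosterman (a b : F) : C := \sum_(t | t != 0) psi (a * t + b / t).

Lemma kloosterman_scale a b c :
  c != 0 -> kloosterman (a * c) (b / c) = kloosterman a b.
Proof.
move=> c0; rewrite /kloosterman [RHS](reindex_inj (mulfI c0)) /=.
apply: eq_big => [t|t _]; first by rewrite mulf_eq0 (negPf c0).
by rewrite invfM !mulrA.
Qed.

Let nonzero_pairs : {set F * F} := [set u : F * F | (u.1 != 0) && (u.2 != 0)].

(** The frequencies in the square of a Kloosterman sum: K(a, b)^2 is the sum of psi(ax + by) over
    the nonzero pairs u, where (x, y) = [sums u]. *)
Let sums (u : F * F) := (u.1 + u.2, u.1^-1 + u.2^-1).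

(* If [s + t = s' + t'] and [1/s + 1/t = 1/s' + 1/t'], then either both sums
   vanish or also [st = s't'], so that [{s, t} = {s', t'}]. *)
Lemma card_kloosterman_quadruples :
  (#|[set s : (F * F) * (F * F) |
      [&& s.1 \in nonzero_pairs,
          s.2 \in nonzero_pairs &
          sums s.1 == sums s.2]]| <= 3 * #|F| ^ 2)%N.
Proof.
pose f1 (u : F * F) := (u, u); pose f2 (u : F * F) := (u, (u.2, u.1)).
pose f3 (u : F * F) := ((u.1, - u.1), (u.2, - u.2)).
have cF : #|{: F * F}| = (#|F| ^ 2)%N by rewrite card_prod expnS expn1.
have cim (f : F * F -> (F * F) * (F * F)) : (#|f @: [set: F * F]%SET| <= #|F| ^ 2)%N.
  by rewrite -cF -cardsT; apply: leq_imset_card.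
apply: (@leq_trans #|f1 @: [set: F * F]%SET :|: f2 @: [set: F * F]%SET :|: f3 @: [set: F * F]%SET|).
  apply/subset_leq_card/fintype.subsetP => -[[s t] [s' t']].
  rewrite !inE /= => /and3P[/andP[s0 t0] /andP[s'0 t'0] /eqP[E1 E2]].
  have [st0|st0] := eqVneq (s + t) 0.
    apply/orP; right; apply/imsetP; exists (s, s'); first by rewrite inE.
    rewrite /f3 /=.
    have -> : t = - s by apply/eqP; rewrite -addr_eq0 addrC st0.
    by have -> : t' = - s' by apply/eqP; rewrite -addr_eq0 addrC -E1 st0.
  have E3 : s * t = s' * t'.
    have e1 : (s + t) * (s' * t') = (s^-1 + t^-1) * (s * t) * (s' * t').
      by field; rewrite s0 t0.
    have e2 : (s + t) * (s * t) = (s'^-1 + t'^-1) * (s' * t') * (s * t).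
      by rewrite E1; field; rewrite s'0 t'0.
    by apply: (mulfI st0); rewrite e1 e2 -E2; ring.
  (* Equal sums and products make s' a root of X^2 - (s + t)X + st = (X - s)(X - t). *)
  have : (s' - s) * (s' - t) == 0.
    apply/eqP; transitivity (s' * s' - s' * (s + t) + s * t); first by ring.
    by rewrite E1 E3; ring.
  rewrite mulf_eq0 !subr_eq0 => /orP[] /eqP es; subst s'.
    have et : t = t' by apply: (addrI s).
    by subst t'; apply/orP; left; apply/orP; left; apply/imsetP; exists (s, t); rewrite ?inE.
  have et : s = t' by apply: (addrI t); rewrite addrC.
  by subst t'; apply/orP; left; apply/orP; right; apply/imsetP; exists (s, t); rewrite ?inE.
apply: leq_trans (leq_card_setU _ _) _.
apply: (leq_trans (leq_add (leq_trans (leq_card_setU _ _)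
  (leq_add (cim f1) (cim f2))) (cim f3))).
by rewrite !mulSn mul0n addn0 addnA.
Qed.

(** Parseval's identity on F x F, applied to the square of the Kloosterman sum, turns the fourth
    moment into q^2 times the number of quadruples counted above. *)
Lemma kloosterman_fourth_moment :
  \sum_ab `|kloosterman ab.1 ab.2| ^+ 4 <= 3 * #|F|%:R ^+ 4.
Proof.
pose e (ab xy : F * F) := psi (ab.1 * xy.1 + ab.2 * xy.2).
have orth v w : \sum_u e u v * (e u w)^* = (#|F| ^ 2)%:R *+ (v == w).
  transitivity ((\sum_u psi (u * v.1) * (psi (u * w.1))^*) *
                (\sum_u psi (u * v.2) * (psi (u * w.2))^*)).
    rewrite mulr_suml; under [RHS]eq_bigr => a _ do rewrite mulr_sumr.
    rewrite pair_big /=; apply: eq_bigr => -[a b] _.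
    by rewrite /e /= !psiD rmorphM /= mulrACA.
  rewrite !psi_orthogonal -pair_eqE /= natrX expr2.
  by case: eqP; case: eqP => _ _; rewrite /= ?mulr1n ?mulr0n ?mulr0 ?mul0r.
have := sum_sqr_norm_orthogonal nonzero_pairs sums orth.
rewrite (_ : \sum_u _ = \sum_ab `|kloosterman ab.1 ab.2| ^+ 4); last first.
  apply: eq_bigr => -[a b] _ /=; rewrite -[4%N]/(2 * 2)%N exprM -[in RHS]normrX.
  congr (`|_| ^+ _); rewrite /kloosterman expr2 mulr_suml.
  under [in RHS]eq_bigr => t _ do rewrite mulr_sumr.
  rewrite pair_big /=; apply: eq_big => [u|u _]; first by rewrite inE.
  by rewrite /e /sums /= -psiD; congr psi; ring.
move=> ->; rewrite natrX.
have := card_kloosterman_quadruples.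
rewrite -(ler_nat C) natrM natrX => H.
apply: (@le_trans _ _ (#|F|%:R ^+ 2 * (3 * #|F|%:R ^+ 2))).
  by apply: ler_wpM2l => //; rewrite exprn_ge0.
by rewrite mulrCA -exprD.
Qed.

(** The q - 1 distinct frequencies (ac, b/c) share the value K(a, b), so (q - 1)|K(a, b)|^4 is at
    most the fourth moment 3q^4. The constant 6 comes from q <= 2(q - 1). *)
Lemma kloosterman_bound a b :
  (a != 0) || (b != 0) -> `|kloosterman a b| ^+ 4 <= 6 * #|F|%:R ^+ 3.
Proof.
move=> ab0; set q : C := #|F|%:R.
have q2 : 2 <= q by rewrite ler_nat finRing_gt1.
pose f (c : F) := (a * c, b / c).
have f_inj : {in predC1 0 &, injective f}.
  move=> c d; rewrite !inE => c0 d0 [E1 E2]; case/orP: ab0 => [a0|b0].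
    exact: mulfI E1.
  by apply: invr_inj; apply: (mulfI b0).
have le1 : (q - 1) * `|kloosterman a b| ^+ 4 <= 3 * q ^+ 4.
  apply: le_trans kloosterman_fourth_moment.
  rewrite (bigID (mem (f @: predC1 0))) /=.
  rewrite -[leLHS]addr0 lerD //; last by apply: sumr_ge0 => *; rewrite exprn_ge0.
  rewrite big_imset //= (eq_bigr (fun _ => `|kloosterman a b| ^+ 4)); last first.
    by move=> c; rewrite inE => c0; rewrite kloosterman_scale.
  rewrite sumr_const cardC1 -mulr_natl -subn1 natrB //.
  by apply: ltnW; apply: finRing_gt1.
have q0 : 0 < q - 1 by rewrite subr_gt0 (lt_le_trans _ q2) // ltr1n.
rewrite -(ler_pM2l q0); apply: (le_trans le1).
rewrite -subr_ge0.
have -> : (q - 1) * (6 * q ^+ 3) - 3 * q ^+ 4 = 3 * q ^+ 3 * (q - 2) by ring.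
by rewrite mulr_ge0 ?subr_ge0 // mulr_ge0 ?exprn_ge0 ?ler0n.
Qed.

(* The majorant is [x |-> #{j in J | x + j in I} / #|J|]. Its Fourier transform
   is a product, hence summable by Parseval's identity. *)
Lemma fourier_majorant (I J : {set F}) : (0 < #|J|)%N ->
  exists c : F -> C,
    [/\ c 0 = #|I|%:R / #|F|%:R,
        \sum_k `|c k| <= #|F|%:R / #|J|%:R,
        forall x, 0 <= \sum_k c k * psi (k * x) &
        forall x, (forall j, j \in J -> x + j \in I) ->
          \sum_k c k * psi (k * x) = 1].
Proof.
move=> J_gt0; set q : C := #|F|%:R; set m : C := #|J|%:R.
have q0 : q != 0 by rewrite pnatr_eq0 -lt0n; apply/card_gt0P; exists 0.
have m0 : m != 0 by rewrite pnatr_eq0 -lt0n.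
have q_ge0 : 0 <= q by rewrite ler0n.
have m_ge0 : 0 <= m by rewrite ler0n.
pose a k := \sum_(y in I) psi (k * y); pose b k := \sum_(j in J) psi (k * j).
have sqr_sum (S : {set F}) :
    \sum_k `|\sum_(y in S) psi (k * y)| ^+ 2 = q * #|S|%:R.
  rewrite (sum_sqr_norm_orthogonal S id psi_orthogonal); congr (_ * _%:R).
  rewrite -(card_imset (mem S) (f := fun x => (x, x))); last by move=> x y [].
  apply: eq_card => -[x y]; rewrite !inE /=; apply/and3P/imsetP => /=.
    by case=> xS _ /eqP <-; exists x.
  by case=> z zS [-> ->].
(* Up to normalization and conjugation, [a] and [b] are the Fourier transforms of the indicators of
   [I] and [J]; the majorant is a convolution, so its coefficients are their products. *)
exists (fun k => (a k)^* * b k / (q * m)).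
have val x : \sum_k (a k)^* * b k / (q * m) * psi (k * x) =
    m^-1 * #|[set j in J | x + j \in I]|%:R.
  transitivity (\sum_(j in J) \sum_(y in I)
     (\sum_k psi (k * (x + j)) * (psi (k * y))^*) / (q * m)).
    under [RHS]eq_bigr => j _ do under eq_bigr => y _ do rewrite mulr_suml.
    under [RHS]eq_bigr => j _ do rewrite exchange_big /=.
    rewrite exchange_big /=; apply: eq_bigr => k _.
    rewrite /a /b rmorph_sum /= mulrAC -mulrA mulr_suml.
    rewrite [RHS]exchange_big /= [LHS]mulr_suml; apply: eq_bigr => y _.
    rewrite !(mulr_suml, mulr_sumr); apply: eq_bigr => j _.
    by rewrite mulrDr psiD; ring.
  rewrite (eq_bigr (fun j => if x + j \in I then m^-1 else 0)); last first.
    have term j y : (\sum_k psi (k * (x + j)) * (psi (k * y))^*) / (q * m) =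
        if y == x + j then m^-1 else 0.
      rewrite psi_orthogonal eq_sym; case: eqP => _.
        by rewrite mulr1n invfM mulrA divff // mul1r.
      by rewrite mulr0n mul0r.
    move=> j _; under eq_bigr => y _ do rewrite term.
    case: ifP => xjI.
      by rewrite (bigD1 (x + j)) //= eqxx big1 ?addr0 // => y /andP[_ /negPf->].
    by rewrite big1 // => y yI; case: eqP => // yE; rewrite yE xjI in yI.
  rewrite -big_mkcondr sumr_const mulr_natr; congr (_ *+ _).
  by apply: eq_card => j; rewrite !inE.
split.
- have sum0 (S : {set F}) : \sum_(y in S) psi (0 * y) = #|S|%:R.
    by rewrite -sumr_const; apply: eq_bigr => y _; rewrite mul0r psi0.
  by rewrite /a /b !sum0 rmorph_nat -/m invfM mulrACA divff // mulr1.
(* The inequality 2xy <= x^2 + y^2 reduces the l^1 norm to two Parseval sums, each at most q^2. This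
   crude bound suffices because [J] will contain a fixed proportion of the field. *)
- have step k : `|(a k)^* * b k / (q * m)| <=
     (`|a k| ^+ 2 + `|b k| ^+ 2) / 2 / (q * m).
    rewrite normrM normfV normrM norm_conjC (ger0_norm (mulr_ge0 q_ge0 m_ge0)).
    apply: ler_wpM2r; first by rewrite invr_ge0 mulr_ge0.
    rewrite ler_pdivlMr ?ltr0n // -subr_ge0.
    have -> : `|a k| ^+ 2 + `|b k| ^+ 2 - `|a k| * `|b k| * 2
      = (`|a k| - `|b k|) ^+ 2 by ring.
    by rewrite real_exprn_even_ge0 // rpredB // normr_real.
  apply: (le_trans (ler_sum _ (fun k _ => step k))).
  rewrite -!mulr_suml big_split /= !sqr_sum -mulrDr.
  have le_q (S : {set F}) : #|S|%:R <= q by rewrite ler_nat max_card.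
  apply: (@le_trans _ _ (q * (q + q) / 2 / (q * m))).
    do 2 (apply: ler_wpM2r; first by rewrite invr_ge0 ?mulr_ge0 ?ler0n).
    by apply: ler_wpM2l => //; apply: lerD.
  rewrite [leLHS](_ : _ = q / m) //.
  by field; rewrite m0 q0.
- by move=> x; rewrite val mulr_ge0 ?ler0n ?invr_ge0.
- move=> x xJ; rewrite val (_ : [set j in J | _] = J) ?mulVf //.
  by apply/setP => j; rewrite inE; apply: andb_idr => /xJ.
Qed.

(** The indicator of the box is majorized by the product of the one-dimensional majorants. In its
    Fourier expansion the zero frequency gives the main term; all others together cost at most
    [sigma] times the l^1 norm, which factors over the coordinates. *)
Lemma card_box_le (T : finType) (Q : {set T}) (d : nat) (v : T -> 'I_d -> F)
    (I J : 'I_d -> {set F}) (sigma : C) :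
  (forall i, 0 < #|J i|)%N -> 0 <= sigma ->
  (forall xi : {ffun 'I_d -> F}, xi != 0 ->
     `|\sum_(t in Q) psi (\sum_i xi i * v t i)| <= sigma) ->
  #|[set t in Q | [forall i, [forall j in J i, v t i + j \in I i]]]|%:R <=
  (\prod_i (#|I i|%:R / #|F|%:R)) * #|Q|%:R +
  (\prod_i (#|F|%:R / #|J i|%:R)) * sigma.
Proof.
move=> J_gt0 sigma_ge0 S_le.
have /fin_all_exists [c cP] : forall i, exists c : {ffun F -> C},
    [/\ c 0 = #|I i|%:R / #|F|%:R,
        \sum_k `|c k| <= #|F|%:R / #|J i|%:R,
        forall x, 0 <= \sum_k c k * psi (k * x) &
        forall x, (forall j, j \in J i -> x + j \in I i) ->
          \sum_k c k * psi (k * x) = 1].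
  move=> i; have [c [c0 c1 c2 c3]] := fourier_majorant (I i) (J_gt0 i).
  exists (finfun c); split; first by rewrite ffunE.
  - by under eq_bigr do rewrite ffunE.
  - by move=> x; under eq_bigr do rewrite ffunE.
  - by move=> x; under eq_bigr do rewrite ffunE; exact: c3.
pose f t := \prod_i \sum_k c i k * psi (k * v t i).
have f_ge0 t : 0 <= f t by apply: prodr_ge0 => i _; case: (cP i).
have fE : \sum_(t in Q) f t = \sum_(xi : {ffun 'I_d -> F})
    (\prod_i c i (xi i)) * \sum_(t in Q) psi (\sum_i xi i * v t i).
  under [RHS]eq_bigr => xi _ do rewrite mulr_sumr.
  rewrite exchange_big /=; apply: eq_bigr => t _.
  rewrite /f bigA_distr_bigA /=; apply: eq_bigr => xi _.
  by rewrite big_split /= psi_sum.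
have cnt_le : #|[set t in Q | [forall i, [forall j in J i, v t i + j \in I i]]]|%:R
    <= \sum_(t in Q) f t.
  rewrite -sumr_const (big_mkcond (fun t => t \in [set _ in Q | _])) /=.
  rewrite [leRHS]big_mkcond /=; apply: ler_sum => t _; rewrite inE.
  case: ifP => [/andP[-> /forallP H]|_]; last by case: ifP.
  rewrite /f big1 // => i _; case: (cP i) => _ _ _ -> // j jJ.
  by move/forall_inP: (H i); apply.
apply: (le_trans cnt_le).
(* The order on [C] is partial: bounding the remainder by its modulus requires it to be real, which
   holds because it is the difference of two real numbers. *)
have sum_real : \sum_(t in Q) f t \is Num.real.
  by apply: ger0_real; apply: sumr_ge0.
move: sum_real; rewrite fE (bigD1 (0 : {ffun 'I_d -> F})) //=.
have -> : \sum_(t in Q) psi (\sum_i (0 : {ffun 'I_d -> F}) i * v t i) = #|Q|%:R.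
  rewrite -sumr_const; apply: eq_bigr => t _.
  by rewrite big1 ?psi0 // => i _; rewrite ffunE mul0r.
have -> : \prod_i c i ((0 : {ffun 'I_d -> F}) i) = \prod_i (#|I i|%:R / #|F|%:R).
  by apply: eq_bigr => i _; rewrite ffunE; case: (cP i).
set main := _ * #|Q|%:R; set rest := \sum_(_ | _) _.
have main_real : main \is Num.real.
  apply: ger0_real; rewrite mulr_ge0 ?ler0n //.
  by apply: prodr_ge0 => i _; rewrite divr_ge0 ?ler0n.
move=> mr; have rest_real : rest \is Num.real.
  by rewrite -[rest](addKr main) addrC rpredB.
rewrite lerD2l; apply: (le_trans (real_ler_norm rest_real)).
apply: (le_trans (ler_norm_sum _ _ _)).
apply: (@le_trans _ _ (\sum_(xi : {ffun 'I_d -> F}) (\prod_i `|c i (xi i)|) * sigma)).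
  rewrite [leRHS](bigID (fun xi => xi != 0)) /= -[leLHS]addr0 lerD //.
    apply: ler_sum => xi xi0; rewrite normrM normr_prod.
    by apply: ler_wpM2l (S_le _ xi0); apply: prodr_ge0.
  by apply: sumr_ge0 => xi _; rewrite mulr_ge0 // prodr_ge0.
rewrite -mulr_suml -(bigA_distr_bigA (fun i k => `|c i k|)).
apply: ler_wpM2r => //; apply: ler_prod => i _.
by case: (cP i) => _ -> _ _; rewrite sumr_ge0.
Qed.


(** Translation along the basis vector [i0] embeds H x F into the whole space: the linear form
    recovers the translation parameter because [w i0] is nonzero. *)
Lemma card_hyperplane_le (m : nat) (w : 'I_m -> F) (i0 : 'I_m) :
  w i0 != 0 ->
  (#|[set x : 'rV[F]_m | (\sum_i w i * x 0 i == 0)%R]| * #|F| <= #|F| ^ m)%N.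
Proof.
move=> wi0; set H := [set x | _].
pose f (xt : 'rV[F]_m * F) := xt.1 + xt.2 *: delta_mx 0 i0.
have sumf x t : \sum_i w i * f (x, t) 0 i = \sum_i w i * x 0 i + w i0 * t.
  under eq_bigr => i _ do rewrite !mxE eqxx /= mulrDr.
  rewrite big_split /=; congr (_ + _); rewrite (bigD1 i0) //= eqxx mulr1.
  by rewrite big1 ?addr0 // => i /negPf->; rewrite mulr0 mulr0.
have cardV : #|{: 'rV[F]_m}| = (#|F| ^ m)%N by rewrite card_mx mul1n.
rewrite -cardV -[in leqLHS]cardsT -cardsX -(card_in_imset (f := f)).
  by apply: max_card.
move=> [x t] [y s]; rewrite !inE !andbT /= => /eqP x0 /eqP y0 E.
have ts : t = s.
  by apply: (mulfI wi0); move: (sumf x t); rewrite E sumf x0 y0 !add0r.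
by move: E; rewrite /f ts /= => /addIr ->.
Qed.

(** * Exponential sums over GL_n *)

Variable n : nat.
Implicit Type A : 'M[F]_n.

Definition unitmx_set : {set 'M[F]_n} := [set A | A \in unitmx].

Definition inverse_pair A : 'rV[F]_(n * n + n * n) :=
  row_mx (mxvec A) (mxvec (invmx A)).

(* Replacing [A] by [t *: A] and averaging over [t] turns the sum over GL_n into
   Kloosterman sums, degenerate only for [A] on a hyperplane. *)
Lemma unitmx_sum_bound (delta : C) (xi : {ffun 'I_(n * n + n * n) -> F}) :
  0 <= delta -> 6 * #|F|%:R ^+ 3 <= (delta * #|F|%:R) ^+ 4 -> xi != 0 ->
  (#|F|%:R - 1) *
    `|\sum_(A in unitmx_set) psi (\sum_i xi i * inverse_pair A 0 i)| <=
  #|unitmx_set|%:R * (delta * #|F|%:R) + #|F|%:R ^+ (n * n).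
Proof.
move=> delta_ge0 delta_large xi0; set q : C := #|F|%:R; set S := \sum_(_ in _) _.
pose L A := \sum_i xi (lshift (n * n) i) * mxvec A 0 i.
pose M A := \sum_i xi (rshift (n * n) i) * mxvec A 0 i.
have SE : S = \sum_(A in unitmx_set) psi (L A + M (invmx A)).
  apply: eq_bigr => A _; rewrite big_split_ord /=.
  by congr (psi (_ + _)); apply: eq_bigr => i _; rewrite (row_mxEl, row_mxEr).
have LZ t A : L (t *: A) = L A * t.
  by rewrite /L mulr_suml; apply: eq_bigr => i _; rewrite linearZ mxE mulrCA mulrC.
have MZ t A : M (t *: A) = M A * t.
  by rewrite /M mulr_suml; apply: eq_bigr => i _; rewrite linearZ mxE mulrCA mulrC.
have avg : (q - 1) * S = \sum_(A in unitmx_set) kloosterman (L A) (M (invmx A)).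
  transitivity (\sum_(t : F | t != 0) S).
    rewrite sumr_const cardC1 -mulr_natl -subn1 natrB //.
    by apply: ltnW; apply: finRing_gt1.
  rewrite /kloosterman [RHS]exchange_big /=; apply: eq_bigr => t t0.
  rewrite SE (reindex_inj (scalerI t0)) /=; apply: eq_big => A.
    by rewrite !inE unitmxZ // unitfE.
  rewrite inE unitmxZ ?unitfE // => uA.
  by rewrite LZ invmxZ ?unitmxZ ?unitfE // MZ.
pose Z := [set A in unitmx_set | (L A == 0) && (M (invmx A) == 0)].
have q_ge0 : 0 <= q by rewrite ler0n.
have q1 : 0 <= q - 1 by rewrite subr_ge0 ler1n; apply: ltnW; apply: finRing_gt1.
have cardZ : #|Z|%:R * q <= q ^+ (n * n).
  rewrite -natrX -natrM ler_nat.
  have [i xi_i] : exists i, xi i != 0.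
    apply/existsP; apply: contra_neqT xi0 => /existsPn H.
    by apply/ffunP => i; rewrite ffunE; apply/eqP; rewrite -[_ == _]negbK H.
  (* If the nonzero coordinate of [xi] lies in the first half, [Z] itself lies on the hyperplane L =
     0; otherwise the inverses of its elements lie on M = 0, and inversion is injective. *)
  have [h [h_inj [w [i0 [w0 wP]]]]] : exists h : 'M[F]_n -> 'rV[F]_(n * n),
      injective h /\ exists w i0, w i0 != 0 /\
      forall A, A \in Z -> \sum_i w i * h A 0 i == 0.
    case: (splitP i) xi_i => [j ij|j ij] xi_i.
      exists mxvec; split; first exact: can_inj mxvecK.
      exists (fun j => xi (lshift (n * n) j)), j; split.
        by rewrite (_ : lshift _ j = i) //; apply: val_inj.
      by move=> A; rewrite inE => /andP[_ /andP[]].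
    exists (mxvec \o invmx); split.
      by apply: inj_comp (can_inj mxvecK) (can_inj invmxK).
    exists (fun j => xi (rshift (n * n) j)), j; split.
      by rewrite (_ : rshift _ j = i) //; apply: val_inj.
    by move=> A; rewrite inE => /andP[_ /andP[]].
  apply: leq_trans (card_hyperplane_le w0); rewrite leq_mul2r; apply/orP; right.
  rewrite -(card_imset _ h_inj); apply/subset_leq_card/fintype.subsetP => x.
  by case/imsetP => A AZ ->; rewrite inE; apply: wP.
rewrite -(ger0_norm q1) -normrM avg; apply: (le_trans (ler_norm_sum _ _ _)).
apply: (@le_trans _ _ (\sum_(A in unitmx_set) (delta * q + (A \in Z)%:R * q))).
  (* On [Z] there are at most q terms of modulus 1; elsewhere [delta_large] turns the fourth-power
     bound into [delta * q]. *)
  apply: ler_sum => A AQ; have [AZ|AZ] := boolP (A \in Z); rewrite ?mul1r ?mul0r.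
    apply: (@le_trans _ _ q); last by rewrite lerDr mulr_ge0.
    apply: (le_trans (ler_norm_sum _ _ _)).
    under eq_bigr => t _ do rewrite norm_psi.
    by rewrite sumr_const ler_nat max_card.
  rewrite addr0; have dq0 : 0 <= delta * q by rewrite mulr_ge0.
  rewrite -(ler_pXn2r (n := 4)) ?nnegrE //.
  apply: le_trans delta_large; apply: kloosterman_bound.
  by move: AZ; rewrite inE AQ /= negb_and.
rewrite big_split /= sumr_const -[delta * q *+ _]mulr_natl lerD2l.
rewrite -mulr_suml -natr_sum (_ : (\sum_(A in unitmx_set) (A \in Z))%N = #|Z|) //.
rewrite -sum1_card big_mkcond [RHS]big_mkcond; apply: eq_bigr => A _.
by case AZ: (A \in Z); [move: AZ; rewrite inE => /andP[->] | case: ifP].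
Qed.

(** Each factor q^i - 1 in the order of GL_n is at least q^i / 2. This makes the hyperplane error
    q^(n^2) comparable to the order of the group. *)
Lemma card_unitmx_ge : (0 < n)%N -> (#|F| ^ (n * n) <= 2 ^ n * #|unitmx_set|)%N.
Proof.
move=> n_gt0; have q2 := finRing_gt1 F.
have -> : #|unitmx_set| = #|'GL_n[F]%g|.
  (* The group type is built on matrices of size [n.-1.+1], so [n] has to be a visible successor. *)
  rewrite /unitmx_set; case: n n_gt0 => // m _.
  pose f (u : {'GL_m.+1[F]}) : 'M[F]_m.+1 := val u.
  rewrite -[RHS](card_imset _ (val_inj : injective f)).
  apply: eq_card => A; rewrite inE.
  apply/idP/imsetP => [uA|[u _ ->]]; last exact: (valP u).
  by exists (FinRing.unit _ uA); rewrite ?inE.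
rewrite card_GL //; elim: n => [|m IH]; first by rewrite big_geq.
rewrite big_nat_recr //= binS bin1 (_ : m.+1 * m.+1 = m * m + m + m.+1)%N; last by lia.
rewrite !expnD [(2 ^ m.+1)%N]expnSr.
have le2 : (#|F| ^ m.+1 <= 2 * (#|F| ^ m.+1 - 1))%N.
  have : (1 < #|F| ^ m.+1)%N by rewrite -(exp1n m.+1) ltn_exp2r.
  by lia.
apply: leq_trans (leq_mul (leq_mul IH (leqnn (#|F| ^ m))) le2) _.
by apply: eq_leq; ring.
Qed.

End AdditiveCharacter.

(** A root w of 1 + X + ... + X^(p-1) satisfies w^p = 1, and w is not 1 because the polynomial takes
    the value p at 1; the character is x |-> w^x. *)
Lemma additive_character_exists (C : numClosedFieldType) (p : nat) :
  prime p -> exists psi : 'F_p -> C,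
    [/\ psi 0 = 1, {morph psi : x y / x + y >-> x * y} & exists x, psi x != 1].
Proof.
move=> p_pr; have p_gt0 := prime_gt0 p_pr; have p_gt1 := prime_gt1 p_pr.
have /closed_rootP[w] : size (\poly_(i < p) (1 : C)) != 1%N.
  by rewrite size_poly_eq ?oner_eq0 // neq_ltn p_gt1 orbT.
rewrite rootE horner_poly => /eqP w_root.
have w_sum : \sum_(i < p) w ^+ i = 0.
  by rewrite -[RHS]w_root; apply: eq_bigr => i _; rewrite mul1r.
have wp : w ^+ p = 1 by apply/eqP; rewrite -subr_eq0 subrX1 w_sum mulr0.
have w1 : w != 1.
  apply/eqP => wE; move/eqP: w_sum; rewrite wE.
  under eq_bigr => i _ do rewrite expr1n.
  by rewrite sumr_const card_ord pnatr_eq0 eqn0Ngt p_gt0.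
have Zp : (Zp_trunc (pdiv p)).+2 = p by rewrite Fp_cast.
exists (fun x => w ^+ (x : nat)); split => //; last by exists 1; rewrite expr1.
move=> x y /=; set r := (_ %% _)%N.
have -> : r = ((x + y) %% p)%N by rewrite /r; congr (_ %% _)%N.
by rewrite -exprD [in RHS](divn_eq (x + y) p) exprD mulnC exprM wp expr1n mul1r.
Qed.

Local Open Scope classical_set_scope.
Local Open Scope ring_scope.

(** * Upper bound for closed boxes *)

(** Continuity at 0 of the polynomial in X with factors [l i] + X: boxes may be thickened at
    arbitrarily small cost in volume. *)
Lemma prod_add_small (R : realType) (d : nat) (l : 'I_d -> R) (e : R) :
  0 < e -> exists2 eta, 0 < eta & \prod_i (l i + eta) <= \prod_i l i + e.
Proof.
move=> e_gt0; pose P : {poly R} := \prod_i ((l i)%:P + 'X).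
have PE x : P.[x] = \prod_i (l i + x).
  by rewrite horner_prod; apply: eq_bigr => i _; rewrite !hornerE.
have /cvgrPdist_le/(_ _ e_gt0)/nbhs_ballP[r r_gt0 Pr] := @continuous_horner R P 0.
have r_gt0' : 0 < r := r_gt0.
exists (r / 2); first by rewrite divr_gt0.
have := Pr (r / 2); rewrite /ball /= sub0r normrN gtr0_norm ?divr_gt0 // => H.
have {H} : `|P.[0] - P.[r / 2]| <= e by apply: H; lra.
have -> : P.[0] = \prod_i l i by rewrite PE; apply: eq_bigr => i _; rewrite addr0.
rewrite PE.
by rewrite ler_norml => /andP[]; lra.
Qed.

(** [card_box_le] with [sigma] supplied by [unitmx_sum_bound]. The characters take values in [R[i]],
    so the real inequality is proved after embedding it there. *)
Lemma unitmx_box_bound (R : realType) (p n : nat)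
    (I J : 'I_(n * n + n * n) -> {set 'F_p}) (delta : R) :
  prime p -> (forall i, 0 < #|J i|)%N -> 0 <= delta ->
  6 * p%:R ^+ 3 <= (delta * p%:R) ^+ 4 ->
  #|[set A in unitmx_set 'F_p n |
      [forall i, [forall j in J i, inverse_pair A 0 i + j \in I i]]]%SET|%:R <=
  (\prod_i (#|I i|%:R / p%:R)) * #|unitmx_set 'F_p n|%:R +
  (\prod_i (p%:R / #|J i|%:R)) *
    ((#|unitmx_set 'F_p n|%:R * (delta * p%:R) + p%:R ^+ (n * n)) / (p%:R - 1)).
Proof.
move=> p_pr J_gt0 delta_ge0 delta_large.
have p1 : 0 < (p%:R - 1 : R) by rewrite subr_gt0 ltr1n prime_gt1.
have toC (k : nat) : (k%:R : R[i]) = (k%:R : R)%:C%C by rewrite rmorph_nat.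
have [psi [psi0 psiD psi1]] := @additive_character_exists R[i] p p_pr.
move Dsigma : (_ / (p%:R - 1)) => sigma.
have sigma_ge0 : 0 <= sigma.
  by rewrite -Dsigma divr_ge0 ?(ltW p1) // addr_ge0 ?exprn_ge0 // !mulr_ge0.
rewrite -lecR rmorphD !rmorphM !rmorph_prod /= -!toC.
under eq_bigr => i _ do rewrite rmorphM fmorphV /= -!toC -[X in _ / X%:R](card_Fp p_pr).
under [X in _ <= _ + X * _]eq_bigr => i _ do
  rewrite rmorphM fmorphV /= -!toC -[X in X%:R / _](card_Fp p_pr).
apply: (card_box_le psi0 psiD psi1 (v := fun A i => inverse_pair A 0 i)) => //.
  by rewrite ler0c.
move=> xi xi0.
have p1C : 0 < (p%:R - 1 : R[i]) by rewrite subr_gt0 ltr1n prime_gt1.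
rewrite -(ler_pM2l p1C).
have := unitmx_sum_bound (delta := delta%:C%C) psi0 psiD psi1 _ _ xi0.
rewrite card_Fp // ler0c delta_ge0 => /(_ isT) H; apply: (le_trans (H _)).
  by move: delta_large; rewrite -lecR !(rmorphM, rmorphXn) /= -!toC.
have : #|unitmx_set 'F_p n|%:R * (delta * p%:R) + p%:R ^+ (n * n)
    = (p%:R - 1) * sigma by rewrite -Dsigma [RHS]mulrC divfK // gt_eqF.
move/(congr1 (real_complex R)).
by rewrite rmorphD !rmorphM rmorphB rmorphXn /= -!toC => ->.
Qed.

Lemma card_thickened_interval (R : realType) (p m : nat) (a b : R) :
  prime p -> a <= b ->
  #|[set x + j | x in [set x : 'F_p | a <= (x : nat)%:R / p%:R <= b]%SET,
                 j in [set j : 'F_p | (j < m)%N]%SET]%SET|%:R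
  <= (b - a) * p%:R + 1 + m%:R.
Proof.
move=> p_pr ab; set B := [set x : 'F_p | _]%SET; set J := [set j : 'F_p | _]%SET.
have p_gt0 : 0 < (p%:R : R) by rewrite ltr0n prime_gt0.
have len_ge0 : 0 <= (b - a) * p%:R by rewrite mulr_ge0 ?subr_ge0 // ltW.
have [B0|[x1 x1B]] := set_0Vmem B.
  rewrite B0 (_ : imset2 _ _ _ = finset.set0) ?cards0; last first.
    by apply/setP => y; rewrite inE; apply/imset2P => -[x j]; rewrite inE.
  by rewrite !addr_ge0.
(* Every element of the sumset is [x0 + k], where [x0] is the least residue in the interval and k <
   L + 1 + m. Wrapping around modulo p can only lower the count. *)
case: (arg_minnP (fun x : 'F_p => x : nat) x1B) => x0 x0B' x0_min.
have x0B : x0 \in B := x0B'.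
pose L := Num.truncn ((b - a) * p%:R).
pose f (k : 'I_(L.+1 + m)) : 'F_p := x0 + (k : nat)%:R.
apply: (@le_trans _ _ (L.+1 + m)%:R).
  rewrite ler_nat -[leqRHS]card_ord -cardsT; apply: leq_trans (leq_imset_card f _).
  apply/subset_leq_card/fintype.subsetP => _ /imset2P[x j xB jJ ->].
  have x0x := x0_min _ xB.
  have lt_k : (x - x0 + j < L.+1 + m)%N.
    rewrite -addnS leq_add //; last by move: jJ; rewrite inE.
    apply: leqW; rewrite truncn_ge_nat // natrB //.
    have xb : (x : nat)%:R <= b * p%:R.
      by move: xB; rewrite inE => /andP[_]; rewrite ler_pdivrMr.
    have ax0 : a * p%:R <= (x0 : nat)%:R.
      by move: x0B; rewrite inE => /andP[+ _]; rewrite ler_pdivlMr.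
    by rewrite mulrBl lerB.
  apply/imsetP; exists (Ordinal lt_k); rewrite ?inE // /f /= natrD natrB //.
  by rewrite !natr_Zp; ring.
by rewrite natrD lerD2r -natr1 lerD2r truncn_le.
Qed.

(** The proportion mu_p, counting matrices rather than points of the image. *)
Definition gl_frequency (R : realType) (n p : nat)
    (X : set 'rV[R]_(n * n + n * n)) : R :=
  #|[set A in GL n p | `[< X (g R A) >]]%SET|%:R / #|GL n p|%:R.
Arguments gl_frequency {R n} p X.

Lemma gE (R : realType) (n p : nat) (A : 'M['F_p]_n) i :
  g R A 0 i = (inverse_pair A 0 i : nat)%:R / p%:R.
Proof.
have scaledE (B : 'M['F_p]_n) :
    scaled_lift R B = map_mx (fun x : 'F_p => (x : nat)%:R / p%:R) B.
  by apply/matrixP => j k; rewrite !mxE.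
by rewrite /g !scaledE -!map_mxvec -map_row_mx mxE.
Qed.

Lemma GL_gt0 (n p : nat) : (0 < #|GL n p|)%N.
Proof. by apply/card_gt0P; exists 1%:M; rewrite inE unitmx1. Qed.

Lemma gl_frequency_box (R : realType) (n : nat) (a b : 'rV[R]_(n * n + n * n))
    (e : R) : (0 < n)%N -> (forall i, a 0 i <= b 0 i) -> 0 < e ->
  \forall p \near \oo, prime p ->
    gl_frequency p (closed_box a b) <= box_volume a b + e.
Proof.
move=> n_gt0 ab e_gt0; set d := (n * n + n * n)%N.
have [eta eta_gt0 prod_le] := prod_add_small (fun i => b 0 i - a 0 i)
  (divr_gt0 e_gt0 (ltr0Sn R 1)).
(* Thickening by m = p / K residues lengthens a side by at most (1 + m) / p <= 2 / K <= eta, hence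
   adds at most e / 2 to the volume. *)
pose K := (Num.truncn (2 / eta)).+1.
have K_gt0 : 0 < (K%:R : R) by rewrite ltr0n.
have K_eta : 2 / K%:R <= eta.
  by rewrite ler_pdivrMr // mulrC -ler_pdivrMr // ltW // truncnS_gt.
(* A bound, independent of p, for the l^1 norm of the majorant, since p <= 2Km. *)
pose D : R := (2 * K%:R) ^+ d.
have D_gt0 : 0 < D by rewrite exprn_gt0 // mulr_gt0.
have [delta delta_gt0 D_delta] : exists2 delta, 0 < delta & D * (2 * delta) = e / 4.
  exists (e / (8 * D)); first by rewrite divr_gt0 // mulr_gt0.
  by field; rewrite gt_eqF.
near=> p => p_pr.
have pK : (K <= p)%N by near: p; exact: nbhs_infty_ge.
have p2 : 2 <= (p%:R : R) by rewrite ler_nat prime_gt1.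
have p_gt0 : 0 < (p%:R : R) by lra.
have p1_gt0 : 0 < (p%:R - 1 : R) by lra.
(* The first threshold is the condition [delta_large]; the second makes the hyperplane error at most
   e / 4. The Kloosterman error accounts for another e / 4 by the choice of [delta]. *)
have p_delta : 6 / delta ^+ 4 <= p%:R by near: p; exact: nbhs_infty_ger.
have p_D : 4 * D * 2 ^+ n.+1 / e <= p%:R by near: p; exact: nbhs_infty_ger.
have delta_large : 6 * p%:R ^+ 3 <= (delta * p%:R) ^+ 4.
  move: p_delta; rewrite ler_pdivrMr ?exprn_gt0 // => H.
  have -> : (delta * p%:R) ^+ 4 = p%:R * delta ^+ 4 * p%:R ^+ 3 by ring.
  by apply: ler_wpM2r H; rewrite exprn_ge0 // ltW.
pose m := (p %/ K)%N; pose J : {set 'F_p} := [set j : 'F_p | (j < m)%N]%SET.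
have m_gt0 : (0 < m)%N by rewrite divn_gt0.
have p_le : p%:R <= 2 * K%:R * (m%:R : R).
  rewrite -!natrM ler_nat; have := ltn_ceil p (ltn0Sn K.-1); rewrite -/K -/m.
  move=> lt_p; apply: (leq_trans (ltnW lt_p)).
  by rewrite mulSn -mulnA mul2n -addnn [(K * m)%N]mulnC leq_add2r leq_pmull.
have le_mK : m%:R * K%:R <= (p%:R : R) by rewrite -natrM ler_nat leq_trunc_div.
have cardJ : (m <= #|J|)%N.
  pose f (i : 'I_m) : 'F_p := (i : nat)%:R.
  have lt_mp (i : 'I_m) : (i < p)%N.
    exact: leq_trans (ltn_ord i) (leq_div _ _).
  have f_inj : injective f.
    move=> i j /(congr1 (@nat_of_ord _)); rewrite /f !val_Fp_nat //.
    by rewrite !modn_small // => /val_inj.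
  rewrite -[leqLHS]card_ord -(card_imset predT f_inj).
  apply/subset_leq_card/fintype.subsetP => _ /imsetP[i _ ->].
  by rewrite inE /f val_Fp_nat // modn_small.
pose B i : {set 'F_p} := [set x : 'F_p | a 0 i <= (x : nat)%:R / p%:R <= b 0 i]%SET.
pose I i : {set 'F_p} := [set x + j | x in B i, j in J]%SET.
have := @unitmx_box_bound R p n I (fun=> J) delta p_pr
  (fun=> leq_trans m_gt0 cardJ) (ltW delta_gt0) delta_large.
set Q := unitmx_set _ _; set X := [set _ in Q | _]%SET => X_le.
have Q_gt0 : 0 < (#|Q|%:R : R) by rewrite ltr0n; exact: GL_gt0.
rewrite /gl_frequency ler_pdivrMr //.
apply: (@le_trans _ _ #|X|%:R).
  rewrite ler_nat; apply/subset_leq_card/fintype.subsetP => A.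
  rewrite !inE => /andP[-> /asboolP boxA] /=.
  apply/forallP => i; apply/forall_inP => j jJ.
  by apply: imset2_f => //; rewrite inE -gE.
apply: (le_trans X_le).
have -> : box_volume a b + e = (box_volume a b + e / 2) + e / 2 by field.
rewrite [leRHS]mulrDl lerD //.
  apply: ler_wpM2r => //; apply: le_trans prod_le; apply: ler_prod => i _.
  rewrite divr_ge0 ?ler0n //= ler_pdivrMr //.
  apply: (le_trans (card_thickened_interval m p_pr (ab i))).
  rewrite -addrA [leRHS]mulrDl lerD2l; apply: (@le_trans _ _ (2 / K%:R * p%:R)).
    by rewrite mulrAC ler_pdivlMr // mulrDl mul1r [2 * _]mulr_natl lerD // ler_nat.
  by apply: ler_wpM2r => //; apply: ltW.
have prod_D : \prod_(i < d) (p%:R / #|J|%:R) <= D.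
  rewrite prodr_const card_ord /D; apply: lerXn2r; rewrite ?nnegrE ?divr_ge0 ?mulr_ge0 //.
  have J_gt0 : 0 < (#|J|%:R : R) by rewrite ltr0n (leq_trans m_gt0).
  rewrite ler_pdivrMr //; apply: (le_trans p_le); apply: ler_wpM2l; last by rewrite ler_nat.
  by rewrite mulr_ge0.
have card_GL_ge : p%:R ^+ (n * n) <= 2 ^+ n * (#|Q|%:R : R).
  by have := card_unitmx_ge 'F_p n_gt0; rewrite card_Fp // -(ler_nat R) natrM !natrX.
(* The factors 2 come from p <= 2(p - 1). *)
have err : (#|Q|%:R * (delta * p%:R) + p%:R ^+ (n * n)) / (p%:R - 1)
    <= #|Q|%:R * (2 * delta + 2 ^+ n.+1 / p%:R).
  rewrite ler_pdivrMr // -mulrA.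
  apply: (@le_trans _ _ (#|Q|%:R * (delta * p%:R + 2 ^+ n))).
    by rewrite [leRHS]mulrDr lerD2l [leRHS]mulrC.
  apply: ler_wpM2l => //; rewrite [leRHS]mulrDl lerD //.
    by rewrite -mulrA mulrCA; apply: ler_wpM2l; [exact: ltW|lra].
  rewrite exprS [leRHS]mulrAC ler_pdivlMr // -mulrA mulrCA.
  by apply: ler_wpM2l; [rewrite exprn_ge0|lra].
have err_ge0 : 0 <= (#|Q|%:R * (delta * p%:R) + p%:R ^+ (n * n)) / (p%:R - 1) :> R.
  by rewrite divr_ge0 ?(ltW p1_gt0) // addr_ge0 ?exprn_ge0 ?mulr_ge0 ?(ltW delta_gt0).
apply: (le_trans (ler_wpM2r err_ge0 prod_D)).
apply: (le_trans (ler_wpM2l (ltW D_gt0) err)).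
rewrite mulrCA mulrC; apply: ler_wpM2r => //.
have -> : e / 2 = e / 4 + e / 4 by field.
rewrite mulrDr lerD //.
  by rewrite D_delta.
move: p_D; rewrite ler_pdivrMr // mulrA ler_pdivrMr // => H.
by rewrite mulrAC ler_pdivlMr // mulrC mulrA [e * _]mulrC.
Unshelve. all: by end_near.
Qed.

(** * Covers by boxes *)

Lemma box_volume_ge0 (R : realType) (d : nat) (a b : 'rV[R]_d) :
  (forall i, a 0 i <= b 0 i) -> 0 <= box_volume a b.
Proof. by move=> ab; apply: prodr_ge0 => i _; rewrite subr_ge0. Qed.

Lemma area_ge0 (R : realType) (d : nat) (X : set 'rV[R]_d) : (0 <= area X)%E.
Proof.
apply: le_ereal_inf_tmp => _ [a [b [ab _ ->]]].
by apply: nneseries_ge0 => k _ _; rewrite lee_fin box_volume_ge0.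
Qed.

Lemma area_closed_box (R : realType) (d : nat) (a b : 'rV[R]_d) :
  (0 < d)%N -> (forall i, a 0 i <= b 0 i) ->
  (area (closed_box a b) <= (box_volume a b)%:E)%E.
Proof.
move=> d_gt0 ab; apply: ge_ereal_inf; exists (box_volume a b)%:E => //.
(* The cover is padded with one-point boxes, of volume 0 because d > 0. *)
pose c (x : 'rV[R]_d) k := if k == 0%N then x else 0.
exists (c a), (c b).
split; first by case=> [|k] i.
  by move=> x xab; exists 0%N.
rewrite nneseries_recl //=; last first.
  by case=> [|k] _; rewrite lee_fin box_volume_ge0.
rewrite eseries0 ?adde0 // => -[//|k] _ _.
by rewrite /box_volume (bigD1 (Ordinal d_gt0)) //= subrr mul0r.
Qed.

Definition open_box (R : realType) (d : nat) (a b : 'rV[R]_d) : set 'rV[R]_d :=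
  [set x | forall i, a 0 i < x 0 i < b 0 i].

Lemma open_box_closed_box (R : realType) (d : nat) (a b : 'rV[R]_d) :
  open_box a b `<=` closed_box a b.
Proof. by move=> x xab i; have /andP[? ?] := xab i; rewrite !ltW. Qed.

Lemma open_open_box (R : realType) (d : nat) (a b : 'rV[R]_d) : open (open_box a b).
Proof.
rewrite openE => x xab.
apply: (@filter_forall _ _ (fun i (y : 'rV[R]_d) => is_true (a 0 i < y 0 i < b 0 i))
  (nbhs x)) => i.
have xi : x 0 i \in `]a 0 i, b 0 i[ by rewrite in_itv /= xab.
have xi_near : nbhs x [set y | y 0 i \in `]a 0 i, b 0 i[].
  exact: (@coord_continuous R 1 d 0 i x _ (near_in_itvoo xi)).
by apply: filterS xi_near => y /=; rewrite in_itv.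
Qed.

Lemma compact_closed_box (R : realType) (d : nat) (a b : 'rV[R]_d) :
  compact (closed_box a b).
Proof.
have -> : closed_box a b = [set v | forall i, `[a 0 i, b 0 i]%classic (v ord0 i)].
  by apply/seteqP; split => x /= H i; have := H i; rewrite in_itv.
by apply: (@rV_compact R d (fun i => `[a 0 i, b 0 i]%classic)) => i; apply: segment_compact.
Qed.

Lemma closed_closed_box (R : realType) (d : nat) (a b : 'rV[R]_d) :
  closed (closed_box a b).
Proof.
exact: compact_closed (@norm_hausdorff R 'rV[R]_d) (@compact_closed_box R d a b).
Qed.

Lemma unit_cubeE (R : realType) (d : nat) :
  unit_cube R d = closed_box 0 (const_mx 1).
Proof.
apply/seteqP; split => x H i; have := H i; first by rewrite in_itv !mxE.
by rewrite in_itv !mxE.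
Qed.

(* Only partial sums occur, so that no infinite sum has to be rearranged when
   two covers are merged. *)
Definition covered_within (R : realType) (d : nat) (X : set 'rV[R]_d) (r : R) :=
  exists a b : nat -> 'rV[R]_d,
    [/\ forall k i, a k 0 i <= b k 0 i,
        X `<=` \bigcup_k open_box (a k) (b k) &
        forall N, \sum_(0 <= k < N) box_volume (a k) (b k) <= r].

Lemma covered_withinS (R : realType) (d : nat) (X Y : set 'rV[R]_d) (r s : R) :
  X `<=` Y -> r <= s -> covered_within Y r -> covered_within X s.
Proof.
move=> XY rs [a [b [ab Yc sum_le]]]; exists a, b; split => //.
  exact: subset_trans Yc.
by move=> N; apply: le_trans rs.
Qed.

(** The slack t between r and the total volume of a closed cover pays for enlarging its boxes to
    open ones: the k-th enlargement costs at most t / 2^(k+1). *)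
Lemma area_lt_covered (R : realType) (d : nat) (X : set 'rV[R]_d) (r : R) :
  (area X < r%:E)%E -> covered_within X r.
Proof.
move/ereal_inf_lt => [_ [a [b [ab Xc ->]]]].
set s := (\sum_(_ <= _ <oo) _)%E => s_lt.
have vol_ge0 k : (0%N <= k)%N -> true -> (0 <= (box_volume (a k) (b k))%:E)%E.
  by rewrite lee_fin box_volume_ge0.
have s_ge0 : (0 <= s)%E by apply: nneseries_ge0 => k *; apply: vol_ge0.
have s_fin : s \is a fin_num by rewrite ge0_fin_numE // (lt_trans s_lt) // ltry.
pose t := r - fine s.
have t_gt0 : 0 < t by rewrite subr_gt0 -lte_fin fineK.
have /choice[eta etaP] : forall k, exists eta, 0 < eta /\
    \prod_i (b k 0 i - a k 0 i + eta) <=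
    \prod_i (b k 0 i - a k 0 i) + t / 2 ^+ k.+1.
  move=> k; have tk_gt0 : 0 < t / 2 ^+ k.+1 by rewrite divr_gt0 // exprn_gt0.
  by have [eta ? ?] := prod_add_small (fun i => b k 0 i - a k 0 i) tk_gt0; exists eta.
exists (fun k => \row_i (a k 0 i - eta k / 2)), (fun k => \row_i (b k 0 i + eta k / 2)).
split.
- move=> k i; rewrite !mxE; have [eta_gt0 _] := etaP k; have := ab k i; lra.
- move=> x /Xc[k _ xk]; exists k => // i; rewrite !mxE.
  by have [eta_gt0 _] := etaP k; have /andP[? ?] := xk i; apply/andP; split; lra.
move=> N; apply: (@le_trans _ _ (\sum_(0 <= k < N) (box_volume (a k) (b k) + t / 2 ^+ k.+1))).
  apply: ler_sum => k _; have [_ le_k] := etaP k.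
  rewrite [leLHS](_ : _ = \prod_i (b k 0 i - a k 0 i + eta k)) //.
  by apply: eq_bigr => i _; rewrite !mxE; field.
rewrite big_split /=.
have geo : \sum_(0 <= k < N) t / 2 ^+ k.+1 = t - t / 2 ^+ N.
  elim: N => [|N IH]; first by rewrite big_geq // expr0 divr1 subrr.
  by rewrite big_nat_recr //= IH exprS; field; rewrite expf_neq0.
have part_le : \sum_(0 <= k < N) box_volume (a k) (b k) <= fine s.
  by rewrite -lee_fin fineK // -sumEFin; apply: nneseries_lim_ge.
have : 0 <= t / 2 ^+ N by rewrite divr_ge0 ?ltW // exprn_gt0.
rewrite geo; move: part_le; rewrite /t; lra.
Qed.

Lemma covered_withinU (R : realType) (d : nat) (X Y : set 'rV[R]_d) (r s : R) :
  covered_within X r -> covered_within Y s -> covered_within (X `|` Y) (r + s).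
Proof.
move=> [a [b [ab Xc r_le]]] [a' [b' [ab' Yc s_le]]].
(* The covers are interleaved. A partial sum of N terms is at most that of 2N terms, which splits
   into N terms of each cover. *)
pose A k := if odd k then a' k./2 else a k./2.
pose B k := if odd k then b' k./2 else b k./2.
have AB k i : A k 0 i <= B k 0 i by rewrite /A /B; case: ifP.
exists A, B; split => //.
- move=> x [/Xc[k _ xk]|/Yc[k _ xk]].
    by exists k.*2 => //; rewrite /A /B odd_double doubleK.
  by exists k.*2.+1 => //; rewrite /A /B /= odd_double /= uphalf_double.
move=> N; apply: (@le_trans _ _ (\sum_(0 <= k < N.*2) box_volume (A k) (B k))).
  rewrite [leRHS](big_cat_nat (n := N)) //=; last by rewrite -addnn leq_addr.
  by rewrite lerDl sumr_ge0 // => k _; apply: box_volume_ge0.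
have -> : \sum_(0 <= k < N.*2) box_volume (A k) (B k) =
    \sum_(0 <= k < N) box_volume (a k) (b k) + \sum_(0 <= k < N) box_volume (a' k) (b' k).
  elim: N => [|N IH]; first by rewrite !big_geq // addr0.
  rewrite doubleS !big_nat_recr //= IH /A /B /= odd_double /= doubleK uphalf_double.
  by rewrite addrACA addrA.
exact: lerD.
Qed.

(** * Negligible sets and the boundaries of rectangles *)

Definition negligible_set (R : realType) (d : nat) (X : set 'rV[R]_d) :=
  forall e : R, 0 < e -> covered_within X e.

Lemma negligible_set_bigcup (R : realType) (d : nat) (I : finType)
    (X : I -> set 'rV[R]_d) : (0 < d)%N ->
  (forall i, negligible_set (X i)) -> negligible_set (\bigcup_i X i).
Proof.
move=> d_gt0 X_null.
suff H (s : seq I) : negligible_set [set x | exists2 i, i \in s & X i x].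
  move=> e e_gt0; apply: covered_withinS (lexx e) (H (enum I) e e_gt0).
  by move=> x [i _ Xix]; exists i; rewrite ?mem_enum.
elim: s => [|i s IH] e e_gt0.
  exists (fun=> 0), (fun=> 0); split => //; first by move=> x [].
  move=> N; rewrite big1 ?ltW // => k _.
  by rewrite /box_volume (bigD1 (Ordinal d_gt0)) //= subrr mul0r.
have e2_gt0 : 0 < e / 2 by rewrite divr_gt0.
rewrite [e](splitr e); apply: (covered_withinS _ (lexx _)
  (covered_withinU (X_null i _ e2_gt0) (IH _ e2_gt0))).
move=> x [j]; rewrite inE => /orP[/eqP -> Xi|js Xj]; [by left|by right; exists j].
Qed.

Lemma negligible_degenerate_box (R : realType) (d : nat) (a b : 'rV[R]_d) i :
  (forall i, a 0 i <= b 0 i) -> a 0 i = b 0 i -> negligible_set (closed_box a b).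
Proof.
move=> ab abi e e_gt0; apply: area_lt_covered.
have d_gt0 : (0 < d)%N by case: (d) i {a b ab abi} => // -[].
apply: (le_lt_trans (area_closed_box d_gt0 ab)).
by rewrite lte_fin /box_volume (bigD1 i) //= abi subrr mul0r.
Qed.

(** Endpoints are clipped to [0, 1], with 0 and 1 standing in for infinite ends, so that all kinds
    of intervals are treated alike. The point [x] excludes empty intervals and yields [lo <= hi]. *)
Lemma unit_interval_hull (R : realType) (I : interval R) (x : R) :
  x \in I -> [set` I] `<=` [set` `[0, 1]] ->
  exists lo hi, [/\ 0 <= lo, lo <= hi, hi <= 1,
    forall y, y \in I -> lo <= y <= hi & forall y, lo < y < hi -> y \in I].
Proof.
move=> xI I01.
have y01 y : y \in I -> 0 <= y <= 1 by move=> /I01; rewrite /= in_itv.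
have lb b l y : (BSide b l <= BLeft y)%O -> l <= y :> R.
  by case: b; rewrite bnd_simp // => /ltW.
have rb b h y : (BRight y <= BSide b h)%O -> y <= h :> R.
  by case: b; rewrite bnd_simp // => /ltW.
have lbV b l y : l < y :> R -> (BSide b l <= BLeft y)%O.
  by case: b; rewrite bnd_simp // => /ltW.
have rbV b h y : y < h :> R -> (BRight y <= BSide b h)%O.
  by case: b; rewrite bnd_simp // => /ltW.
pose lo := if I is Interval (BSide _ l) _ then Num.max l 0 else 0.
pose hi := if I is Interval _ (BSide _ h) then Num.min h 1 else 1.
have sub y : y \in I -> lo <= y <= hi.
  move=> yI; have /andP[y0 y1] := y01 _ yI; move: yI; rewrite /lo /hi.
  case: (I) => -[b l|b] [c h|c]; rewrite itv_boundlr => /andP[Il Ir];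
    rewrite ?ge_max ?le_min y0 y1 ?andbT //.
  - by rewrite (lb _ _ _ Il) (rb _ _ _ Ir).
  - exact: lb Il.
  - exact: rb Ir.
exists lo, hi; split => //.
- by rewrite /lo; case: (I) => -[b l|b] _ //; rewrite le_max lexx orbT.
- by have /andP[] := sub _ xI; apply: le_trans.
- by rewrite /hi; case: (I) => _ [b h|b] //; rewrite ge_min lexx orbT.
move=> y; move: xI; rewrite /lo /hi.
case: (I) => -[b l|b] [c h|c]; rewrite !itv_boundlr => /andP[Il Ir];
  rewrite ?gt_max ?lt_min => /andP[].
- by move=> /andP[/lbV -> _] /andP[/rbV -> _].
- by move=> /andP[/lbV -> _] _; case: c Ir.
- by move=> _ /andP[/rbV -> _]; rewrite andbT; case: b Il {Ir}.
- by case: b Il; case: c Ir.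
Qed.

(** For a nonempty rectangle, [U] and [C] are the open and closed boxes with the same endpoints;
    they differ by 2d faces, each a degenerate box. *)
Lemma rectangle_approx (R : realType) (d : nat) (B : set 'rV[R]_d) :
  (0 < d)%N -> is_rectangle B ->
  exists U C : set 'rV[R]_d,
    [/\ open U, closed C, C `<=` unit_cube R d, U `<=` B /\ B `<=` C &
        negligible_set (C `\` U)].
Proof.
move=> d_gt0 [I [I01 ->]].
have [[x xI]|empty] := pselect (exists x : 'rV[R]_d, forall i, x 0 i \in I i); last first.
  exists set0, set0; split; [exact: open0|exact: closed0|by []| |].
    by split => // y yI; apply: empty; exists y.
  rewrite setDv => e e_gt0.
  have H := @negligible_set_bigcup R d void (fun=> set0) d_gt0 (fun i => match i with end).
  by apply: covered_withinS (lexx e) (H e e_gt0).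
have /choice[lo /choice[hi lohi]] : forall i, exists lo hi, [/\ 0 <= lo, lo <= hi, hi <= 1,
    forall y, y \in I i -> lo <= y <= hi & forall y, lo < y < hi -> y \in I i].
  by move=> i; apply: unit_interval_hull (xI i) (I01 i).
pose a : 'rV[R]_d := \row_i lo i; pose b : 'rV[R]_d := \row_i hi i.
exists (open_box a b), (closed_box a b); split.
- exact: open_open_box.
- exact: closed_closed_box.
- move=> y yab i; have := yab i; rewrite !mxE in_itv /=.
  by have [? _ ? _ _] := lohi i; move=> /andP[? ?]; apply/andP; split; lra.
- split=> y yI i; have [_ _ _ Iab abI] := lohi i; last by rewrite !mxE Iab.
  by apply: abI; have := yI i; rewrite !mxE.
(* The lower i-th face is the box from [a] to [b' i], the upper one the box from [a' i] to [b]. *)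
pose a' i : 'rV[R]_d := \row_j (if j == i then hi j else lo j).
pose b' i : 'rV[R]_d := \row_j (if j == i then lo j else hi j).
pose X (ic : 'I_d * bool) := if ic.2 then closed_box a (b' ic.1) else closed_box (a' ic.1) b.
have X_null ic : negligible_set (X ic).
  case: ic => i [] /=; apply: (@negligible_degenerate_box _ _ _ _ i); rewrite ?mxE ?eqxx //;
  by move=> j; rewrite !mxE; case: eqP; have [_ ? _ _ _] := lohi j.
move=> e e_gt0; apply: covered_withinS (lexx e) (negligible_set_bigcup d_gt0 X_null e_gt0).
move=> y [yC yO]; have [i yi] : exists i, ~ (a 0 i < y 0 i < b 0 i).
  by apply/existsNP.
have := yC i; move: yi; rewrite !mxE => /negP; rewrite negb_and -!leNgt => /orP[le|le] /andP[le1 le2].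
  exists (i, true) => // j; rewrite /= !mxE; case: eqP => [->|_]; first by rewrite le1.
  by have := yC j; rewrite !mxE.
exists (i, false) => // j; rewrite /= !mxE; case: eqP => [->|_]; first by rewrite le2 le.
by have := yC j; rewrite !mxE.
Qed.

(** * Equidistribution *)

Lemma gl_frequency_le (R : realType) (n p : nat) (X Y : set 'rV[R]_(n * n + n * n)) :
  X `<=` Y -> gl_frequency p X <= gl_frequency p Y.
Proof.
move=> XY; apply: ler_wpM2r; first by rewrite invr_ge0.
rewrite ler_nat; apply/subset_leq_card/fintype.subsetP => A.
by rewrite !inE => /andP[-> /asboolP XA]; apply/asboolP/XY.
Qed.

Lemma gl_frequency_bigcup (R : realType) (n p N : nat)
    (X : nat -> set 'rV[R]_(n * n + n * n)) :
  gl_frequency p (\bigcup_(k in `I_N) X k) <= \sum_(k < N) gl_frequency p (X k).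
Proof.
rewrite /gl_frequency -mulr_suml -natr_sum; apply: ler_wpM2r; first by rewrite invr_ge0.
rewrite ler_nat; pose S (k : 'I_N) := [set A in GL n p | `[< X k (g R A) >]]%SET.
apply: (@leq_trans #|(\bigcup_k S k)%SET|); last first.
  apply: (big_ind2 (fun (A : {set 'M['F_p]_n}) m => #|A| <= m)%N); rewrite ?cards0 //.
  move=> A m B m' Am Bm; exact: leq_trans (leq_card_setU _ _) (leq_add Am Bm).
apply/subset_leq_card/fintype.subsetP => A.
rewrite inE => /andP[GA /asboolP[k /= kN XA]].
by apply/finset.bigcupP; exists (Ordinal kN); rewrite // inE GA; apply/asboolP.
Qed.

Lemma g_unit_cube (R : realType) (n p : nat) (A : 'M['F_p]_n) :
  prime p -> unit_cube R (n * n + n * n) (g R A).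
Proof.
move=> p_pr i; rewrite in_itv /= gE divr_ge0 //= ler_pdivrMr ?ltr0n ?prime_gt0 //.
rewrite mul1r ler_nat ltnW // -[X in (_ < X)%N](Fp_cast p_pr); exact: ltn_ord.
Qed.

Lemma gl_frequencyC (R : realType) (n p : nat) (X : set 'rV[R]_(n * n + n * n)) :
  prime p -> gl_frequency p (unit_cube R _ `\` X) = 1 - gl_frequency p X.
Proof.
move=> p_pr; have GL0 : #|GL n p|%:R != 0 :> R by rewrite pnatr_eq0 -lt0n GL_gt0.
apply/eqP; rewrite eq_sym subr_eq eq_sym /gl_frequency -mulrDl -natrD.
rewrite (_ : (_ + _)%N = #|GL n p|) ?divff //.
rewrite addnC -(cardsID [set A | `[< X (g R A) >]]%SET (GL n p)); congr (_ + _)%N.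
  by apply: eq_card => A; rewrite !inE.
apply: eq_card => A; rewrite !inE andbC; congr andb.
apply/asboolP/idP => [[_ XA]|/asboolP XA]; last by split => //; exact: g_unit_cube.
by apply/asboolP.
Qed.

(** Residues can be read off the coordinates of [g], so [g] is injective and points of the image
    correspond to matrices. *)
Lemma image_g_frequency (R : realType) (n p : nat) (X : set 'rV[R]_(n * n + n * n)) :
  prime p ->
  (#|` fset_set (image_g R n p `&` X)|)%:R / #|GL n p|%:R = gl_frequency p X.
Proof.
move=> p_pr; congr (_%:R / _).
have g_inj : injective (@g R n p).
  move=> A B gAB; have E i : inverse_pair A 0 i = inverse_pair B 0 i.
    apply/val_inj; have := congr1 (fun M : 'rV_(n * n + n * n) => M 0 i) gAB.
    rewrite /= !gE => /(mulIf _) H; apply/eqP; rewrite -(eqr_nat R); apply/eqP/H.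
    by rewrite invr_eq0 pnatr_eq0 -lt0n prime_gt0.
  have /(congr1 lsubmx) : inverse_pair A = inverse_pair B by apply/rowP.
  by rewrite !row_mxKl => /(can_inj mxvecK).
set Q := [set A in GL n p | _]%SET.
pose s := [seq g R A | A <- enum Q]; pose D := seq_fset tt s.
have -> : image_g R n p `&` X = [set` D].
  apply/seteqP; split => [_ [[A GA <-] XA]|x].
    change (g R A \in D); rewrite seq_fsetE; apply/mapP; exists A => //.
    by rewrite mem_enum inE; apply/andP; split => //; apply/asboolP.
  change (x \in D -> (image_g R n p `&` X) x).
  rewrite seq_fsetE => /mapP[A]; rewrite mem_enum inE => /andP[GA /asboolP XA] ->.
  by split => //; exists A.
rewrite set_fsetK size_seq_fset undup_id ?size_map -?cardE //.
by rewrite map_inj_uniq // enum_uniq.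
Qed.

(** Finitely many of the open boxes cover [X]. Each of the first N closed boxes obeys the box bound
    up to e / N, and their volumes form a partial sum, hence total at most r. *)
Lemma gl_frequency_compact (R : realType) (n : nat) (X : set 'rV[R]_(n * n + n * n))
    (r e : R) : (0 < n)%N -> compact X -> covered_within X r -> 0 < e ->
  \forall p \near \oo, prime p -> gl_frequency p X <= r + e.
Proof.
move=> n_gt0 + [a [b [ab Xc r_le]]] e_gt0.
rewrite compact_cover => /(_ nat setT (fun k => open_box (a k) (b k))).
move=> /(_ (fun k _ => @open_open_box R _ (a k) (b k)) Xc)[D _ XD].
pose N := (\max_(k <- D) k)%N.+1.
have XN : X `<=` \bigcup_(k in `I_N) closed_box (a k) (b k).
  move=> x /XD[k /= kD xk]; exists k; last exact: open_box_closed_box.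
  by rewrite /= ltnS; apply: leq_bigmax_seq.
have eN_gt0 : 0 < e / N%:R by rewrite divr_gt0.
have nearH : \forall p \near \oo, forall k : 'I_N, prime p ->
    gl_frequency p (closed_box (a k) (b k)) <= box_volume (a k) (b k) + e / N%:R.
  apply: (@filter_forall nat 'I_N (fun k p => prime p ->
    gl_frequency p (closed_box (a k) (b k)) <= box_volume (a k) (b k) + e / N%:R)
    (nbhs \oo)) => k.
  exact: gl_frequency_box.
apply: filterS nearH => p H p_pr; apply: (le_trans (gl_frequency_le p XN)).
apply: (le_trans (gl_frequency_bigcup _ _ _)).
apply: (le_trans (ler_sum _ (fun k _ => H k p_pr))).
rewrite big_split /= sumr_const card_ord -[_ *+ N]mulr_natr divfK ?pnatr_eq0 //.
by rewrite lerD2r; have := r_le N; rewrite big_mkord.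
Qed.

(** The closures of the outer rectangles form a compact set containing [E]; it is covered by [E],
    the excess of the outer rectangles and their boundaries. Three quarters of e go to these covers,
    the last to the compact bound. *)
Lemma gl_frequency_upper (R : realType) (n : nat) (E : set 'rV[R]_(n * n + n * n))
    (r e : R) : (0 < n)%N -> approximable_by_rectangles E ->
  (area E <= r%:E)%E -> 0 < e ->
  \forall p \near \oo, prime p -> gl_frequency p E <= r + e.
Proof.
move=> n_gt0 E_approx area_le e_gt0.
have d_gt0 : (0 < n * n + n * n)%N by rewrite addn_gt0 muln_gt0 n_gt0.
have e4_gt0 : 0 < e / 4 by rewrite divr_gt0.
have [k [l [inner [outer [_ [out_rect _] [_ E_out] _ out_small]]]]] := E_approx _ e4_gt0.
have /choice[U /choice[C UC]] := fun j => rectangle_approx d_gt0 (out_rect j).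
pose K := \bigcup_j C j.
have K_compact : compact K.
  have : closed K.
    by apply: closed_bigcup => [|j _]; [exact: finite_finset|have [] := UC j].
  move=> K_closed; apply: (subclosed_compact K_closed (@compact_closed_box R _ 0 (const_mx 1))).
  by rewrite -unit_cubeE => x [j _ xC]; have [_ _ CC _ _] := UC j; exact: CC.
have E_cov : covered_within E (r + e / 4).
  by apply: area_lt_covered; apply: (le_lt_trans area_le); rewrite lte_fin; lra.
have null : negligible_set (\bigcup_j (C j `\` U j)).
  by apply: negligible_set_bigcup => // j; have [] := UC j.
have K_cov : covered_within K (r + e / 4 + e / 4 + e / 4).
  apply: covered_withinS (lexx _) (covered_withinU
    (covered_withinU E_cov (area_lt_covered out_small)) (null _ e4_gt0)).
  move=> x [j _ xC]; have [xE|xE] := pselect (E x); first by left; left.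
  have [xO|xO] := pselect (outer j x); first by left; right; split => //; exists j.
  by right; exists j => //; split => // xU; apply: xO; have [_ _ _ [UO _] _] := UC j; exact: UO.
have nearH := gl_frequency_compact n_gt0 K_compact K_cov e4_gt0.
apply: filterS nearH => p H p_pr; apply: le_trans (gl_frequency_le p _) (le_trans (H p_pr) _).
  by move=> x /E_out[j _ xO]; exists j => //; have [_ _ _ [_ OC] _] := UC j; exact: OC.
lra.
Qed.

Lemma area_unit_cube_le (R : realType) (d : nat) :
  (0 < d)%N -> (area (unit_cube R d) <= 1%:E)%E.
Proof.
move=> d_gt0; rewrite unit_cubeE; apply: le_trans (area_closed_box d_gt0 _) _.
  by move=> i; rewrite !mxE.
by rewrite lee_fin /box_volume big1 // => i _; rewrite !mxE subr0.
Qed.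

Lemma area_unit_cubeD (R : realType) (d : nat) (E : set 'rV[R]_d) (r : R) :
  (0 < d)%N -> E `<=` unit_cube R d -> lebesgue_measurable E -> area E = r%:E ->
  (area (unit_cube R d `\` E) <= (1 - r)%:E)%E.
Proof.
(* [area] is only an outer measure, so additivity comes from Caratheodory's condition with the cube
   as test set. *)
move=> d_gt0 E_cube /(_ (unit_cube R d)); rewrite setIidr // => cubeE Er.
rewrite EFinB leeBrDr // -Er addeC [X in (X <= _)%E](_ : _ = area (unit_cube R d)) //.
exact: area_unit_cube_le.
Qed.

(** The dual argument bounds the frequency of the complement: the cube minus the interiors of the
    inner rectangles is compact and exceeds the cube minus [E] by a set of small area and negligible
    boundaries. *)
Lemma gl_frequency_lower (R : realType) (n : nat) (E : set 'rV[R]_(n * n + n * n))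
    (r e : R) : (0 < n)%N -> E `<=` unit_cube R (n * n + n * n) ->
  approximable_by_rectangles E ->
  (area (unit_cube R _ `\` E) <= (1 - r)%:E)%E -> 0 < e ->
  \forall p \near \oo, prime p -> r - e <= gl_frequency p E.
Proof.
move=> n_gt0 E_cube E_approx area_le e_gt0.
have d_gt0 : (0 < n * n + n * n)%N by rewrite addn_gt0 muln_gt0 n_gt0.
have e4_gt0 : 0 < e / 4 by rewrite divr_gt0.
have [k [l [inner [outer [[in_rect _] _ [in_E _] in_small _]]]]] := E_approx _ e4_gt0.
have /choice[U /choice[C UC]] := fun j => rectangle_approx d_gt0 (in_rect j).
pose K := unit_cube R (n * n + n * n) `\` \bigcup_j U j.
have K_compact : compact K.
  have K_closed : closed K.
    rewrite /K setDE unit_cubeE; apply: closedI; first exact: closed_closed_box.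
    by apply: open_closedC; apply: bigcup_open => j _; have [] := UC j.
  apply: (subclosed_compact K_closed (@compact_closed_box R _ 0 (const_mx 1))).
  by rewrite -unit_cubeE => x [].
have E_cov : covered_within (unit_cube R _ `\` E) (1 - r + e / 4).
  by apply: area_lt_covered; apply: (le_lt_trans area_le); rewrite lte_fin; lra.
have null : negligible_set (\bigcup_j (C j `\` U j)).
  by apply: negligible_set_bigcup => // j; have [] := UC j.
have K_cov : covered_within K (1 - r + e / 4 + e / 4 + e / 4).
  apply: covered_withinS (lexx _) (covered_withinU
    (covered_withinU E_cov (area_lt_covered in_small)) (null _ e4_gt0)).
  move=> x [x01 xU]; have [xE|xE] := pselect (E x); last by left; left.
  have [[j _ xj]|xI] := pselect ((\bigcup_i inner i) x); last by left; right.
  right; exists j => //; have [_ _ _ [_ IC] _] := UC j.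
  by split; [exact: IC|move=> xUj; apply: xU; exists j].
have nearH := gl_frequency_compact n_gt0 K_compact K_cov e4_gt0.
apply: filterS nearH => p H p_pr.
have : gl_frequency p (unit_cube R _ `\` E) <= gl_frequency p K.
  apply: gl_frequency_le => x [x01 xE]; split => // -[j _ xU]; apply: xE.
  by apply: in_E; exists j => //; have [_ _ _ [UI _] _] := UC j; exact: UI.
by have := H p_pr; rewrite gl_frequencyC //; lra.
Qed.

Theorem theorem1p2 (R : realType) (n : nat) (n_gt0 : (0 < n)%N)
    (E : set 'rV[R]_(n * n + n * n))
    (E_cube : E `<=` unit_cube R (n * n + n * n))
    (E_meas : lebesgue_measurable E)
    (E_approx : approximable_by_rectangles E) :
  (fun p : nat =>
     ((#|` fset_set (image_g R n p `&` E)|)%:R / (#|GL n p|)%:R : R)%:E)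
    @ within [set p | prime p] \oo --> area E.
Proof.
have d_gt0 : (0 < n * n + n * n)%N by rewrite addn_gt0 muln_gt0 n_gt0.
(* Caratheodory's condition on the cube bounds the area of [E] by 1; the limit is then finite and
   the convergence can be proved in [R]. *)
have area_E_le : (area E <= 1%:E)%E.
  apply: le_trans (area_unit_cube_le R d_gt0); have := E_meas (unit_cube R _).
  by rewrite setIidr // => ->; rewrite leeDl // area_ge0.
have area_fin : area E \is a fin_num.
  by rewrite ge0_fin_numE ?area_ge0 // (le_lt_trans area_E_le) // ltry.
have Er := esym (fineK area_fin); set r := fine _ in Er; rewrite Er.
apply/fine_cvgP; split; first by apply: nearW.
apply/cvgrPdist_le => e e_gt0; rewrite near_withinE.
have area_le : (area E <= r%:E)%E by rewrite Er.
have upper := gl_frequency_upper n_gt0 E_approx area_le e_gt0.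
have lower := gl_frequency_lower n_gt0 E_cube E_approx
  (area_unit_cubeD d_gt0 E_cube E_meas Er) e_gt0.
apply: filterS2 upper lower => p upper lower p_pr /=.
by rewrite image_g_frequency // ler_distlC lower // upper.
Qed.
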